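(* Let $\mathbb C$ be a Mal'cev category which is fiberwise algebraically cartesian closed. Let $R$ be any equivalence relation on an object $X$, with projections $d_0,d_1:R\rightrightarrows X$ and reflexivity map $s_0:X\to R$. Then the centralizer $Z(R)$ of the equivalence relation $R$ exists in $\mathbb C$, and it is given by the domain of the split epimorphism $\Phi_{d_1}[p_R,(1,d_0)]$ above $X$, where $(p_R,(1,d_0)):R\times X\rightleftarrows R$ is regarded as an object of $Pt_R\mathbb C$, and $\Phi_{d_1}:Pt_R\mathbb C\to Pt_X\mathbb C$ is the right adjoint of $d_1^*:Pt_X\mathbb C\to Pt_R\mathbb C$. (The inclusion $(d_0,d_1):Z(R)\rightarrowtail X\times X$ is the map in $Pt_X\mathbb C$, over the object $(p_0,s_0):X\times X\rightleftarrows X$, obtained from the counit $\varepsilon_{d_1}(p_R,(1,d_0)):d_1^*\Phi_{d_1}[p_R,(1,d_0)]\to (p_R,(1,d_0))$ by pulling back along the section $s_0:X\rightarrowtail R$ of $d_1$.)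
   Context: For a finitely complete category $\mathbb C$ and an object $Y$, $Pt_Y\mathbb C$ has as objects the pairs $(f:X\to Y,\ s:Y\to X)$ with $fs=1_Y$, and as morphisms the maps over $Y$ commuting with the sections. For $h:X\to Y$, $h^*:Pt_Y\mathbb C\to Pt_X\mathbb C$ is the change of base functor given by pulling back along $h$. A category $\mathbb D$ is unital when it is pointed, finitely complete, and for all $A,B$ the pair $(1_A,0):A\to A\times B$, $(0,1_B):B\to A\times B$ is jointly strongly epic. In such a category, maps $f:A\to C$, $g:B\to C$ commute when there is a (unique) $\phi:A\times B\to C$ with $\phi(1_A,0)=f$, $\phi(0,1_B)=g$. A finitely complete category $\mathbb C$ is Mal'cev when every reflexive relation in it is an equivalence relation; equivalently, when every $Pt_Y\mathbb C$ is unital. A category $\mathbb D$ with products is algebraically cartesian closed when for every object $Y$ with terminal map $\tau_Y:Y\to 1$ the functor $\tau_Y^*:Pt_1\mathbb D\to Pt_Y\mathbb D$ has a right adjoint. $\mathbb C$ is fiberwise algebraically cartesian closed when every fibre $Pt_Y\mathbb C$ is algebraically cartesian closed; equivalently, when for every split epimorphism $f:X\to Y$ in $\mathbb C$, $f^*:Pt_Y\mathbb C\to Pt_X\mathbb C$ has a right adjoint $\Phi_f$. In a Mal'cev category, the subobjects of $(p_0,s_0):X\times X\rightleftarrows X$ ($p_0$ the first projection, $s_0$ the diagonal) in $Pt_X\mathbb C$ are exactly the equivalence relations on $X$. Two equivalence relations $R$ and $S$ on $X$ commute in $\mathbb C$ if and only if the subobjects $(d_1,d_0):(R,d_1,s_0)\rightarrowtail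 (X\times X,p_0,s_0)$ and $(d_0,d_1):(S,d_0,s_0)\rightarrowtail (X\times X,p_0,s_0)$ commute in the unital category $Pt_X\mathbb C$. The centralizer of $R$ is the largest equivalence relation on $X$ commuting with $R$. *)

(* Defs.v *)
From Stdlib Require Import ProofIrrelevance.

Set Implicit Arguments.
Unset Strict Implicit.

(** * Categories, functors, adjunctions *)

Record category := Category {
  ob :> Type;
  hom : ob -> ob -> Type;
  idm : forall A, hom A A;
  comp : forall A B D, hom B D -> hom A B -> hom A D;
  comp_id_l : forall A B (f : hom A B), comp (idm B) f = f;
  comp_id_r : forall A B (f : hom A B), comp f (idm A) = f;
  comp_assoc : forall A B D E (f : hom A B) (g : hom B D) (h : hom D E),
    comp h (comp g f) = comp (comp h g) f
}.

Arguments hom {c} A B.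
Arguments idm {c} A.
Arguments comp {c A B D} g f.

Declare Scope cat_scope.
Open Scope cat_scope.
Notation "A ~> B" := (hom A B) (at level 90, right associativity) : cat_scope.
Notation "g ∘ f" := (comp g f) (at level 40, left associativity) : cat_scope.

Record functor (C D : category) := Functor {
  fob :> C -> D;
  fmap : forall A B : C, (A ~> B) -> (fob A ~> fob B);
  fmap_id : forall A : C, fmap (idm A) = idm (fob A);
  fmap_comp : forall (A B E : C) (f : A ~> B) (g : B ~> E),
    fmap (g ∘ f) = fmap g ∘ fmap f
}.

Arguments fmap {C D} F {A B} f : rename.

Record right_adjoint (C D : category) (F : functor C D) := RightAdjoint {
  radj :> functor D C;
  unit : forall A : C, A ~> radj (F A);
  counit : forall B : D, F (radj B) ~> B;
  unit_nat : forall (A A' : C) (f : A ~> A'),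
    unit A' ∘ f = fmap radj (fmap F f) ∘ unit A;
  counit_nat : forall (B B' : D) (g : B ~> B'),
    g ∘ counit B = counit B' ∘ fmap F (fmap radj g);
  triangle_left : forall A : C, counit (F A) ∘ fmap F (unit A) = idm (F A);
  triangle_right : forall B : D,
    fmap radj (counit B) ∘ unit (radj B) = idm (radj B)
}.

Arguments unit {C D F} r A.
Arguments counit {C D F} r B.

Definition has_right_adjoint (C D : category) (F : functor C D) : Prop :=
  inhabited (right_adjoint F).

Definition is_iso (C : category) (A B : C) (f : A ~> B) : Prop :=
  exists g : B ~> A, g ∘ f = idm A /\ f ∘ g = idm B.

(** * Finite limits *)

Record pullback (C : category) (A B D : C) (f : A ~> D) (g : B ~> D) := Pullback {
  pb_ob : C;
  pb_fst : pb_ob ~> A;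
  pb_snd : pb_ob ~> B;
  pb_comm : f ∘ pb_fst = g ∘ pb_snd;
  pb_pair : forall (T : C) (a : T ~> A) (b : T ~> B),
    f ∘ a = g ∘ b -> (T ~> pb_ob);
  pb_pair_fst : forall (T : C) (a : T ~> A) (b : T ~> B) (e : f ∘ a = g ∘ b),
    pb_fst ∘ pb_pair e = a;
  pb_pair_snd : forall (T : C) (a : T ~> A) (b : T ~> B) (e : f ∘ a = g ∘ b),
    pb_snd ∘ pb_pair e = b;
  pb_uniq : forall (T : C) (u v : T ~> pb_ob),
    pb_fst ∘ u = pb_fst ∘ v -> pb_snd ∘ u = pb_snd ∘ v -> u = v
}.

Arguments pb_fst {C A B D f g} p.
Arguments pb_snd {C A B D f g} p.
Arguments pb_comm {C A B D f g} p.
Arguments pb_pair {C A B D f g} p {T a b} e.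

(* Finite completeness, as a choice of a terminal object and of pullbacks. *)
Record finlim (C : category) := Finlim {
  terminal : C;
  to_terminal : forall A : C, A ~> terminal;
  to_terminal_uniq : forall (A : C) (u v : A ~> terminal), u = v;
  pb : forall (A B D : C) (f : A ~> D) (g : B ~> D), pullback f g
}.

Arguments terminal {C} L : rename.
Arguments to_terminal {C} L A : rename.
Arguments to_terminal_uniq {C} L {A} u v : rename.
Arguments pb {C} L {A B D} f g : rename.

Section Products.
Variables (C : category) (L : finlim C).

Definition prod_pb (A B : C) : pullback (to_terminal L A) (to_terminal L B) :=
  pb L (to_terminal L A) (to_terminal L B).
Definition prod (A B : C) : C := pb_ob (prod_pb A B).
Definition pr1 (A B : C) : prod A B ~> A := pb_fst (prod_pb A B).
Definition pr2 (A B : C) : prod A B ~> B := pb_snd (prod_pb A B).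
Definition pair (T A B : C) (a : T ~> A) (b : T ~> B) : T ~> prod A B :=
  pb_pair (prod_pb A B) (to_terminal_uniq L (to_terminal L A ∘ a) (to_terminal L B ∘ b)).

Lemma pr1_pair (T A B : C) (a : T ~> A) (b : T ~> B) : pr1 A B ∘ pair a b = a.
Proof. apply pb_pair_fst. Qed.
Lemma pr2_pair (T A B : C) (a : T ~> A) (b : T ~> B) : pr2 A B ∘ pair a b = b.
Proof. apply pb_pair_snd. Qed.
Lemma prod_uniq (T A B : C) (u v : T ~> prod A B) :
  pr1 A B ∘ u = pr1 A B ∘ v -> pr2 A B ∘ u = pr2 A B ∘ v -> u = v.
Proof. apply pb_uniq. Qed.
End Products.

(** * The category of points over an object *)

Record point (C : category) (Y : C) := Point {
  pt_dom : C;
  pt_map : pt_dom ~> Y;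
  pt_sec : Y ~> pt_dom;
  pt_split : pt_map ∘ pt_sec = idm Y
}.

Record point_hom (C : category) (Y : C) (P Q : point Y) := PointHom {
  pt_arr : pt_dom P ~> pt_dom Q;
  pt_arr_map : pt_map Q ∘ pt_arr = pt_map P;
  pt_arr_sec : pt_arr ∘ pt_sec P = pt_sec Q
}.

Lemma point_hom_eq (C : category) (Y : C) (P Q : point Y) (u v : point_hom P Q) :
  pt_arr u = pt_arr v -> u = v.
Proof.
  destruct u as [u1 u2 u3], v as [v1 v2 v3]; simpl; intros e; subst v1.
  f_equal; apply proof_irrelevance.
Qed.

Lemma pt_id_map (C : category) (Y : C) (P : point Y) : pt_map P ∘ idm _ = pt_map P.
Proof. apply comp_id_r. Qed.
Lemma pt_id_sec (C : category) (Y : C) (P : point Y) : idm _ ∘ pt_sec P = pt_sec P.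
Proof. apply comp_id_l. Qed.

Section PointComp.
Variables (C : category) (Y : C) (P Q S : point Y).
Variables (g : point_hom Q S) (f : point_hom P Q).
Lemma pt_comp_map : pt_map S ∘ (pt_arr g ∘ pt_arr f) = pt_map P.
Proof. now rewrite comp_assoc, !pt_arr_map. Qed.
Lemma pt_comp_sec : (pt_arr g ∘ pt_arr f) ∘ pt_sec P = pt_sec S.
Proof. now rewrite <- comp_assoc, !pt_arr_sec. Qed.
End PointComp.

Definition Pt (C : category) (Y : C) : category.
Proof.
  refine (@Category (point Y) (@point_hom C Y)
    (fun P => PointHom (pt_id_map P) (pt_id_sec P))
    (fun P Q S g f => PointHom (pt_comp_map g f) (pt_comp_sec g f)) _ _ _).
  - intros; apply point_hom_eq, comp_id_l.
  - intros; apply point_hom_eq, comp_id_r.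
  - intros; apply point_hom_eq, comp_assoc.
Defined.

(** ** Change of base *)

Section ChangeOfBase.
Variables (C : category) (L : finlim C) (X Y : C) (h : X ~> Y).

Lemma cob_sec_eq (P : point Y) : h ∘ idm X = pt_map P ∘ (pt_sec P ∘ h).
Proof. now rewrite comp_assoc, pt_split, comp_id_l, comp_id_r. Qed.

Definition cob_ob (P : point Y) : point X :=
  @Point C X (pb_ob (pb L h (pt_map P))) (pb_fst _)
    (pb_pair (pb L h (pt_map P)) (cob_sec_eq P)) (pb_pair_fst _ _).

Lemma cob_arr_eq (P Q : point Y) (f : point_hom P Q) :
  h ∘ pb_fst (pb L h (pt_map P)) = pt_map Q ∘ (pt_arr f ∘ pb_snd (pb L h (pt_map P))).
Proof. now rewrite comp_assoc, pt_arr_map, pb_comm. Qed.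

Definition cob_hom (P Q : point Y) (f : point_hom P Q) :
  point_hom (cob_ob P) (cob_ob Q).
Proof.
  refine (@PointHom C X (cob_ob P) (cob_ob Q)
    (pb_pair (pb L h (pt_map Q)) (cob_arr_eq f)) (pb_pair_fst _ _) _).
  apply pb_uniq; simpl.
  - now rewrite comp_assoc, !pb_pair_fst.
  - now rewrite comp_assoc, !pb_pair_snd, <- comp_assoc, pb_pair_snd,
      comp_assoc, pt_arr_sec.
Defined.

Definition change_of_base : functor (Pt Y) (Pt X).
Proof.
  refine (@Functor (Pt Y) (Pt X) cob_ob cob_hom _ _).
  - intros P; apply point_hom_eq, pb_uniq; simpl.
    + now rewrite pb_pair_fst, comp_id_r.
    + now rewrite pb_pair_snd, comp_id_l, comp_id_r.
  - intros P Q S f g; apply point_hom_eq, pb_uniq; simpl.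
    + now rewrite comp_assoc, !pb_pair_fst.
    + now rewrite comp_assoc, !pb_pair_snd, <- !comp_assoc, pb_pair_snd.
Defined.
End ChangeOfBase.

(** ** Finite limits and zero object in a category of points *)

Section PointLimits.
Variables (C : category) (L : finlim C) (Y : C).

Definition pt_one : Pt Y := @Point C Y Y (idm Y) (idm Y) (comp_id_l (idm Y)).

Definition pt_to_one (P : Pt Y) : P ~> pt_one :=
  @PointHom C Y P pt_one (pt_map P) (comp_id_l _) (pt_split P).

Definition pt_from_one (P : Pt Y) : pt_one ~> P :=
  @PointHom C Y pt_one P (pt_sec P) (pt_split P) (comp_id_r _).

Section Pullback.
Variables (P Q S : Pt Y) (f : P ~> S) (g : Q ~> S).

Let B := pb L (pt_arr f) (pt_arr g).

Lemma pt_pb_sec_eq : pt_arr f ∘ pt_sec P = pt_arr g ∘ pt_sec Q.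
Proof. now rewrite !pt_arr_sec. Qed.

Lemma pt_pb_split :
  (pt_map P ∘ pb_fst B) ∘ pb_pair B pt_pb_sec_eq = idm Y.
Proof. now rewrite <- comp_assoc, pb_pair_fst, pt_split. Qed.

Lemma pt_pb_snd_map : pt_map Q ∘ pb_snd B = pt_map P ∘ pb_fst B.
Proof.
  rewrite <- (pt_arr_map f), <- (pt_arr_map g), <- !comp_assoc.
  now rewrite pb_comm.
Qed.

Definition pt_pb_ob : Pt Y := Point pt_pb_split.

Definition pt_pb_fst : pt_pb_ob ~> P :=
  @PointHom C Y pt_pb_ob P (pb_fst B) (eq_refl _) (pb_pair_fst _ _).
Definition pt_pb_snd : pt_pb_ob ~> Q :=
  @PointHom C Y pt_pb_ob Q (pb_snd B) pt_pb_snd_map (pb_pair_snd _ _).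

Definition pt_pb_pair (T : Pt Y) (a : T ~> P) (b : T ~> Q) (e : f ∘ a = g ∘ b) :
  T ~> pt_pb_ob.
Proof.
  refine (@PointHom C Y T pt_pb_ob
    (pb_pair B (f_equal (fun u : point_hom T S => pt_arr u) e)) _ _); simpl.
  - now rewrite <- comp_assoc, pb_pair_fst, pt_arr_map.
  - apply pb_uniq; rewrite comp_assoc.
    + now rewrite !pb_pair_fst, pt_arr_sec.
    + now rewrite !pb_pair_snd, pt_arr_sec.
Defined.

Definition pt_pb : pullback f g.
Proof.
  refine (@Pullback (Pt Y) P Q S f g pt_pb_ob pt_pb_fst pt_pb_snd _ pt_pb_pair _ _ _).
  - apply point_hom_eq, pb_comm.
  - intros; apply point_hom_eq, pb_pair_fst.
  - intros; apply point_hom_eq, pb_pair_snd.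
  - intros T u v e1 e2; apply point_hom_eq, pb_uniq.
    + exact (f_equal (fun w : point_hom T P => pt_arr w) e1).
    + exact (f_equal (fun w : point_hom T Q => pt_arr w) e2).
Defined.
End Pullback.

Lemma pt_to_one_uniq (P : Pt Y) (u v : P ~> pt_one) : u = v.
Proof.
  apply point_hom_eq.
  pose proof (pt_arr_map u) as e; pose proof (pt_arr_map v) as e'; simpl in e, e'.
  rewrite comp_id_l in e, e'; congruence.
Qed.

Lemma pt_from_one_uniq (P : Pt Y) (u v : pt_one ~> P) : u = v.
Proof.
  apply point_hom_eq.
  pose proof (pt_arr_sec u) as e; pose proof (pt_arr_sec v) as e'; simpl in e, e'.
  rewrite comp_id_r in e, e'; congruence.
Qed.

Definition pt_finlim : finlim (Pt Y) :=
  @Finlim (Pt Y) pt_one pt_to_one pt_to_one_uniq pt_pb.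
End PointLimits.

(** * Algebraically cartesian closed categories *)

Definition acc (D : category) (L : finlim D) : Prop :=
  forall Y : D, has_right_adjoint (change_of_base L (to_terminal L Y)).

Definition fiberwise_acc (C : category) (L : finlim C) : Prop :=
  forall Y : C, acc (pt_finlim L Y).

(** * Commuting maps in a pointed category *)

(* Pointedness: the terminal object is also initial. *)
Record pointed (D : category) (L : finlim D) := Pointed {
  from_terminal : forall A : D, terminal L ~> A;
  from_terminal_uniq : forall (A : D) (u v : terminal L ~> A), u = v
}.

Definition zero_map (D : category) (L : finlim D) (Z : pointed L) (A B : D) : A ~> B :=
  from_terminal Z B ∘ to_terminal L A.

Definition maps_commute (D : category) (L : finlim D) (Z : pointed L)
    (A B E : D) (f : A ~> E) (g : B ~> E) : Prop :=
  exists phi : prod L A B ~> E,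
    phi ∘ pair L (idm A) (zero_map Z A B) = f /\
    phi ∘ pair L (zero_map Z B A) (idm B) = g.

Definition pt_pointed (C : category) (L : finlim C) (Y : C) : pointed (pt_finlim L Y) :=
  @Pointed (Pt Y) (pt_finlim L Y) (@pt_from_one C Y) (@pt_from_one_uniq C Y).

(** * Internal relations *)

Definition jointly_monic (C : category) (R X : C) (d0 d1 : R ~> X) : Prop :=
  forall (T : C) (u v : T ~> R), d0 ∘ u = d0 ∘ v -> d1 ∘ u = d1 ∘ v -> u = v.

(* [s0] is determined by the other data, as [d0] and [d1] are jointly monic. *)
Record reflexive_relation (C : category) (X : C) := ReflexiveRelation {
  rel_ob : C;
  d0 : rel_ob ~> X;
  d1 : rel_ob ~> X;
  rel_monic : jointly_monic d0 d1;
  s0 : X ~> rel_ob;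
  d0_s0 : d0 ∘ s0 = idm X;
  d1_s0 : d1 ∘ s0 = idm X
}.

Arguments d0 {C X} R : rename.
Arguments d1 {C X} R : rename.
Arguments s0 {C X} R : rename.

Definition symmetric (C : category) (X : C) (R : reflexive_relation X) : Prop :=
  exists t : rel_ob R ~> rel_ob R, d0 R ∘ t = d1 R /\ d1 R ∘ t = d0 R.

Definition transitive (C : category) (L : finlim C) (X : C)
    (R : reflexive_relation X) : Prop :=
  let RR := pb L (d1 R) (d0 R) in
  exists t : pb_ob RR ~> rel_ob R,
    d0 R ∘ t = d0 R ∘ pb_fst RR /\ d1 R ∘ t = d1 R ∘ pb_snd RR.

Definition is_equivalence (C : category) (L : finlim C) (X : C)
    (R : reflexive_relation X) : Prop :=
  symmetric R /\ transitive L R.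

Record equivalence_relation (C : category) (L : finlim C) (X : C) :=
  EquivalenceRelation {
    eqv_rel :> reflexive_relation X;
    eqv_equivalence : is_equivalence L eqv_rel
  }.

Definition malcev (C : category) (L : finlim C) : Prop :=
  forall (X : C) (R : reflexive_relation X), is_equivalence L R.

Definition rel_le (C : category) (X : C) (R S : reflexive_relation X) : Prop :=
  exists u : rel_ob R ~> rel_ob S, d0 S ∘ u = d0 R /\ d1 S ∘ u = d1 R.

(** * Commuting equivalence relations and centralizers *)

Section Centralizer.
Variables (C : category) (L : finlim C) (X : C).

Definition square_point : Pt X :=
  Point (pr1_pair L (idm X) (idm X)).

Definition rel_point1 (R : reflexive_relation X) : Pt X := Point (d1_s0 R).
Definition rel_point0 (R : reflexive_relation X) : Pt X := Point (d0_s0 R).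

Definition rel_incl10 (R : reflexive_relation X) : rel_point1 R ~> square_point.
Proof.
  refine (@PointHom C X (rel_point1 R) square_point (pair L (d1 R) (d0 R)) _ _).
  - apply pr1_pair.
  - apply prod_uniq; simpl; rewrite comp_assoc;
      [ rewrite !pr1_pair; apply d1_s0 | rewrite !pr2_pair; apply d0_s0 ].
Defined.

Definition rel_incl01 (R : reflexive_relation X) : rel_point0 R ~> square_point.
Proof.
  refine (@PointHom C X (rel_point0 R) square_point (pair L (d0 R) (d1 R)) _ _).
  - apply pr1_pair.
  - apply prod_uniq; simpl; rewrite comp_assoc;
      [ rewrite !pr1_pair; apply d0_s0 | rewrite !pr2_pair; apply d1_s0 ].
Defined.

Definition relations_commute (R S : equivalence_relation L X) : Prop :=
  maps_commute (pt_pointed L X) (rel_incl10 R) (rel_incl01 S).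

Definition is_centralizer (R Z : equivalence_relation L X) : Prop :=
  relations_commute R Z /\
  forall S : equivalence_relation L X, relations_commute R S -> rel_le S Z.

Definition target_point (R : equivalence_relation L X) : Pt (rel_ob R) :=
  Point (pr1_pair L (idm (rel_ob R)) (d0 R)).

(* The reflexive relation given by a map in [Pt X] to [square_point] which is
   monic in the base category. *)
Section RelationOfPoint.
Variables (P : Pt X) (m : P ~> square_point).
Hypothesis mono :
  jointly_monic (pr1 L X X ∘ pt_arr m) (pr2 L X X ∘ pt_arr m).

Lemma rel_of_point_d0_s0 : (pr1 L X X ∘ pt_arr m) ∘ pt_sec P = idm X.
Proof.
  rewrite <- comp_assoc.
  exact (eq_trans (f_equal (comp (pr1 L X X)) (pt_arr_sec m)) (pr1_pair L _ _)).
Qed.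
Lemma rel_of_point_d1_s0 : (pr2 L X X ∘ pt_arr m) ∘ pt_sec P = idm X.
Proof.
  rewrite <- comp_assoc.
  exact (eq_trans (f_equal (comp (pr2 L X X)) (pt_arr_sec m)) (pr2_pair L _ _)).
Qed.

Definition rel_of_point : reflexive_relation X :=
  ReflexiveRelation mono rel_of_point_d0_s0 rel_of_point_d1_s0.
End RelationOfPoint.

Variable R : equivalence_relation L X.

Local Notation s0_star := (change_of_base L (s0 R)).
Local Notation d1_star := (change_of_base L (d1 R)).

(* The canonical isomorphism [P ~ s0^* (d1^* P)], due to [d1 ∘ s0 = idm X]. *)
Section Restrict.
Variable P : Pt X.

Lemma restrict_inner_eq : d1 R ∘ (s0 R ∘ pt_map P) = pt_map P ∘ idm _.
Proof. now rewrite comp_assoc, d1_s0, comp_id_l, comp_id_r. Qed.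

Lemma restrict_outer_eq :
  s0 R ∘ pt_map P =
  pt_map (d1_star P) ∘ pb_pair (pb L (d1 R) (pt_map P)) restrict_inner_eq.
Proof. symmetry; apply pb_pair_fst. Qed.

Definition restrict : P ~> s0_star (d1_star P).
Proof.
  refine (@PointHom C X P (s0_star (d1_star P))
    (pb_pair (pb L (s0 R) (pt_map (d1_star P))) restrict_outer_eq)
    (pb_pair_fst _ _) _).
  apply pb_uniq; simpl; rewrite comp_assoc.
  - now rewrite !pb_pair_fst, pt_split.
  - rewrite !pb_pair_snd; apply pb_uniq; rewrite !comp_assoc.
    + now rewrite !pb_pair_fst, <- comp_assoc, pt_split, comp_id_l, comp_id_r.
    + now rewrite !pb_pair_snd, <- comp_assoc, d1_s0, comp_id_l, comp_id_r.
Defined.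

Lemma restrict_iso : is_iso restrict.
Proof.
  set (Q := pb L (d1 R) (pt_map P)).
  set (O := pb L (s0 R) (pb_fst Q)).
  assert (E0 : s0 R ∘ pb_fst O = pb_fst Q ∘ pb_snd O) by apply pb_comm.
  assert (E1 : pt_map P ∘ (pb_snd Q ∘ pb_snd O) = pb_fst O).
  { rewrite comp_assoc, <- pb_comm, <- comp_assoc, <- E0, comp_assoc, d1_s0.
    apply comp_id_l. }
  unshelve eexists (@PointHom C X (s0_star (d1_star P)) P (pb_snd Q ∘ pb_snd O) _ _).
  - exact E1.
  - cbn; fold Q; fold O.
    rewrite <- comp_assoc; unfold O at 2; rewrite pb_pair_snd, comp_assoc.
    unfold Q at 2; rewrite pb_pair_snd.
    now rewrite <- comp_assoc, d1_s0, comp_id_r.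
  - split; apply point_hom_eq; cbn; fold Q; fold O.
    + now rewrite <- comp_assoc, !pb_pair_snd.
    + apply (@pb_uniq _ _ _ _ _ _ O); rewrite comp_assoc.
      * now rewrite pb_pair_fst, E1, comp_id_r.
      * rewrite pb_pair_snd, comp_id_r; apply pb_uniq; rewrite comp_assoc.
        -- now rewrite pb_pair_fst, <- comp_assoc, E1.
        -- now rewrite pb_pair_snd, comp_id_l.
Qed.
End Restrict.

(* The canonical isomorphism from [s0^*] of [(p_R, (1, d0))] to the square. *)
Definition target_to_square : s0_star (target_point R) ~> square_point.
Proof.
  refine (@PointHom C X (s0_star (target_point R)) square_point
    (pair L (pb_fst _) (pr2 L (rel_ob R) X ∘ pb_snd _)) (pr1_pair _ _ _) _).
  apply prod_uniq; simpl; rewrite comp_assoc.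
  - now rewrite !pr1_pair, pb_pair_fst.
  - rewrite !pr2_pair, <- comp_assoc, pb_pair_snd, comp_assoc, pr2_pair.
    apply d0_s0.
Defined.

Lemma target_to_square_iso : is_iso target_to_square.
Proof.
  assert (Ec : s0 R ∘ pr1 L X X =
    pt_map (target_point R) ∘ pair L (s0 R ∘ pr1 L X X) (pr2 L X X))
    by (symmetry; apply pr1_pair).
  unshelve eexists (@PointHom C X square_point (s0_star (target_point R))
    (pb_pair (pb L (s0 R) (pt_map (target_point R))) Ec) (pb_pair_fst _ _) _).
  - apply pb_uniq; simpl; rewrite comp_assoc.
    + now rewrite !pb_pair_fst, pr1_pair.
    + rewrite !pb_pair_snd; apply prod_uniq; rewrite !comp_assoc.
      * now rewrite !pr1_pair, <- comp_assoc, pr1_pair, comp_id_l, comp_id_r.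
      * now rewrite !pr2_pair, d0_s0.
  - split; apply point_hom_eq; simpl.
    + apply pb_uniq; rewrite comp_assoc, comp_id_r.
      * now rewrite pb_pair_fst, pr1_pair.
      * rewrite pb_pair_snd; apply prod_uniq; rewrite comp_assoc.
        -- rewrite pr1_pair, <- comp_assoc, pr1_pair.
           apply (pb_comm (pb L (s0 R) (pt_map (target_point R)))).
        -- now rewrite !pr2_pair.
    + apply prod_uniq; rewrite comp_assoc, comp_id_r.
      * now rewrite pr1_pair, pb_pair_fst.
      * now rewrite pr2_pair, <- comp_assoc, pb_pair_snd, pr2_pair.
Qed.

(* The counit at [(p_R, (1, d0))], pulled back along [s0], read through the two
   canonical isomorphisms. *)
Definition centralizer_map (Phi : right_adjoint d1_star) :
  Phi (target_point R) ~> square_point :=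
  target_to_square ∘ fmap s0_star (counit Phi (target_point R))
    ∘ restrict (Phi (target_point R)).

End Centralizer.

(* Main.v *)
Require Import Defs.
From Stdlib Require Import ProofIrrelevance.

(** A map [P ~> Phi (R × X)] of points over [X] is, by adjunction, a map
    [φ : R ×_X P ~> X] with [φ (r, s_P (d1 r)) = d0 r], and its composite with
    [centralizer_map] is [p ↦ (f_P p, φ (s0 (f_P p), p))].  As [R ×_X P] is the
    product of [(R, d1, s0)] and [P] in [Pt X], such a [φ] is exactly a
    cooperator in [Pt X] between [R] and this composite.  Hence a relation [S]
    commutes with [R] if and only if its inclusion into [X × X] factors through
    [centralizer_map] ([relations_commute_iff] and
    [centralizer_map_transpose]).

    This makes the domain of [Phi (R × X)] the largest relation commuting with
    [R] once [centralizer_map] is known to be monic, and that is where the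
    Mal'cev property enters: relations are difunctional
    ([malcev_difunctional]), so the two axes of a product of points are jointly
    epic ([axes_jointly_epic]) and a cooperator is determined by the two maps
    it extends.  The relation so obtained is reflexive, hence an equivalence.

    The right adjoint of [d1^*] itself comes from cartesian closedness of the
    fibre over [X]: points over [(R, d1, s0)] in [Pt X] are points over [R], and
    points over the zero object of [Pt X] are points over [X]
    ([split_epi_right_adjoint]). *)

Set Implicit Arguments.
Unset Strict Implicit.

(** * Right adjoints from universal arrows *)

Record universal_arrow (C D : category) (F : functor C D) (B : D) := UniversalArrow {
  ua_ob : C;
  ua_arr : F ua_ob ~> B;
  ua_lift : forall A : C, (F A ~> B) -> (A ~> ua_ob);
  ua_lift_arr : forall (A : C) (g : F A ~> B), ua_arr ∘ fmap F (ua_lift g) = g;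
  ua_uniq : forall (A : C) (u v : A ~> ua_ob),
    ua_arr ∘ fmap F u = ua_arr ∘ fmap F v -> u = v
}.

Definition universal_of_adjoint (C D : category) (F : functor C D)
    (G : right_adjoint F) (B : D) : universal_arrow F B.
Proof.
  refine (@UniversalArrow C D F B (G B) (counit G B)
    (fun A g => fmap G g ∘ unit G A) _ _).
  - intros A g.
    now rewrite fmap_comp, comp_assoc, <- counit_nat, <- comp_assoc,
      triangle_left, comp_id_r.
  - intros A.
    assert (H : forall u : A ~> G B,
      u = fmap G (counit G B ∘ fmap F u) ∘ unit G A).
    { intros u.
      now rewrite fmap_comp, <- comp_assoc, <- unit_nat, comp_assoc,
        triangle_right, comp_id_l. }
    intros u v e; rewrite (H u), (H v), e; reflexivity.
Defined.

Definition adjoint_of_universal (C D : category) (F : functor C D)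
    (U : forall B : D, universal_arrow F B) : right_adjoint F.
Proof.
  unshelve refine (let G := @Functor D C (fun B => ua_ob (U B))
    (fun B B' g => ua_lift (U B') (g ∘ ua_arr (U B))) _ _ in _).
  - intros B; apply ua_uniq.
    now rewrite ua_lift_arr, fmap_id, comp_id_l, comp_id_r.
  - intros B B' B'' f g; apply ua_uniq.
    rewrite ua_lift_arr, fmap_comp, (comp_assoc _ _ (ua_arr (U B''))), ua_lift_arr.
    now rewrite <- (comp_assoc _ (ua_arr (U B'))), ua_lift_arr, comp_assoc.
  - refine (@RightAdjoint C D F G (fun A => ua_lift (U (F A)) (idm (F A)))
      (fun B => ua_arr (U B)) _ _ _ _).
    + intros A A' f; apply ua_uniq; simpl.
      rewrite !fmap_comp, !comp_assoc, !ua_lift_arr, comp_id_l.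
      now rewrite <- comp_assoc, ua_lift_arr, comp_id_r.
    + intros B B' g; simpl; now rewrite ua_lift_arr.
    + intros A; apply ua_lift_arr.
    + intros B; apply ua_uniq; simpl.
      rewrite !fmap_comp, !comp_assoc, !ua_lift_arr, fmap_id, comp_id_r.
      now rewrite <- comp_assoc, ua_lift_arr, comp_id_r.
Defined.

(** * Change of base along a split epimorphism *)

Section SplitEpimorphism.
Variables (C : category) (L : finlim C) (Y : C) (Q : Pt Y).

Definition point_over_one (P : Pt Y) : Pt (pt_one Y : Pt Y) :=
  @Point (Pt Y) (pt_one Y) P (pt_to_one P) (pt_from_one P)
    (pt_to_one_uniq _ _).

(** Since [pt_one] is a zero object, the structural maps of a point above it
    carry no information. *)
Lemma point_over_one_surj (G : Pt (pt_one Y : Pt Y)) :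
  {P : Pt Y | point_over_one P = G}.
Proof.
  destruct G as [P m s e]; exists P; unfold point_over_one.
  assert (em : m = pt_to_one P) by apply pt_to_one_uniq.
  assert (es : s = pt_from_one P) by apply pt_from_one_uniq.
  subst m s; f_equal; apply proof_irrelevance.
Qed.

Section NestedPoint.
Variable B : Pt (pt_dom Q).

Lemma nested_split : (pt_map Q ∘ pt_map B) ∘ (pt_sec B ∘ pt_sec Q) = idm Y.
Proof.
  now rewrite <- comp_assoc, (comp_assoc _ (pt_sec B)), pt_split, comp_id_l,
    pt_split.
Qed.

Definition nested_dom : Pt Y := Point nested_split.

Definition nested_map : nested_dom ~> Q.
Proof.
  refine (@PointHom C Y nested_dom Q (pt_map B) eq_refl _); simpl.
  now rewrite comp_assoc, pt_split, comp_id_l.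
Defined.

Definition nested_sec : Q ~> nested_dom.
Proof.
  refine (@PointHom C Y Q nested_dom (pt_sec B) _ eq_refl); simpl.
  now rewrite <- comp_assoc, pt_split, comp_id_r.
Defined.

Lemma nested_point_split : nested_map ∘ nested_sec = idm Q.
Proof. apply point_hom_eq, (pt_split B). Qed.

Definition nested_point : Pt Q := Point nested_point_split.
End NestedPoint.

Local Notation split_star := (change_of_base L (pt_map Q)).
Local Notation fibre_star :=
  (change_of_base (pt_finlim L Y) (to_terminal (pt_finlim L Y) Q)).

Section Transfer.
Variables (P : Pt Y) (B : Pt (pt_dom Q)).

Lemma nest_map (g : split_star P ~> B) :
  (pt_map Q ∘ pt_map B) ∘ pt_arr g = pt_map Q ∘ pb_fst (pb L (pt_map Q) (pt_map P)).
Proof.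
  rewrite <- comp_assoc; f_equal; exact (pt_arr_map g).
Qed.

Lemma nest_sec (g : split_star P ~> B) :
  pt_arr g ∘ pt_sec (pt_dom (fibre_star (point_over_one P))) =
  pt_sec B ∘ pt_sec Q.
Proof.
  rewrite <- (pt_arr_sec g), <- comp_assoc; f_equal.
  apply pb_uniq; simpl; rewrite comp_assoc.
  - now rewrite !pb_pair_fst, comp_id_l.
  - now rewrite !pb_pair_snd, <- comp_assoc, pt_split, comp_id_r.
Qed.

Definition nest_inner (g : split_star P ~> B) :
    pt_dom (fibre_star (point_over_one P)) ~> nested_dom B :=
  @PointHom C Y (pt_dom (fibre_star (point_over_one P))) (nested_dom B)
    (pt_arr g) (nest_map g) (nest_sec g).

Definition nest (g : split_star P ~> B) :
  fibre_star (point_over_one P) ~> nested_point B.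
Proof.
  refine (@PointHom (Pt Y) Q (fibre_star (point_over_one P)) (nested_point B)
    (nest_inner g) _ _).
  - apply point_hom_eq; exact (pt_arr_map g).
  - apply point_hom_eq; simpl; rewrite <- (pt_arr_sec g); f_equal.
    apply pb_uniq; simpl.
    + now rewrite !pb_pair_fst.
    + now rewrite !pb_pair_snd.
Defined.

Definition unnest (g : fibre_star (point_over_one P) ~> nested_point B) :
  split_star P ~> B.
Proof.
  refine (@PointHom C (pt_dom Q) (split_star P) B (pt_arr (pt_arr g)) _ _).
  - exact (f_equal (fun w : point_hom _ _ => pt_arr w) (pt_arr_map g)).
  - refine (eq_trans _
      (f_equal (fun w : point_hom _ _ => pt_arr w) (pt_arr_sec g))); simpl.
    f_equal; apply pb_uniq; simpl.
    + now rewrite !pb_pair_fst.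
    + now rewrite !pb_pair_snd.
Defined.
End Transfer.

Definition over_one_hom (P P' : Pt Y) (u : P ~> P') :
    point_over_one P ~> point_over_one P' :=
  @PointHom (Pt Y) (pt_one Y) (point_over_one P) (point_over_one P') u
    (pt_to_one_uniq _ _) (pt_from_one_uniq _ _).

Lemma fibre_star_arr (P P' : Pt Y)
    (w : point_over_one P ~> point_over_one P') :
  pt_arr (pt_arr (fmap fibre_star w)) = pt_arr (fmap split_star (pt_arr w)).
Proof.
  apply pb_uniq; simpl.
  - now rewrite !pb_pair_fst.
  - now rewrite !pb_pair_snd.
Qed.

Definition split_universal (B : Pt (pt_dom Q))
    (U : universal_arrow fibre_star (nested_point B)) :
  universal_arrow split_star B.
Proof.
  destruct U as [G e l le un].
  destruct (point_over_one_surj G) as [G' E]; destruct E.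
  refine (@UniversalArrow (Pt Y) (Pt (pt_dom Q)) split_star B G' (unnest e)
    (fun P g => pt_arr (l (point_over_one P) (nest g))) _ _).
  - intros P g; apply point_hom_eq.
    refine (eq_trans _ (f_equal (fun w : @point_hom (Pt Y) Q _ _ => pt_arr (pt_arr w))
      (le (point_over_one P) (nest g)))).
    change (pt_arr (pt_arr e) ∘ pt_arr (fmap split_star (pt_arr (l _ (nest g)))) =
      pt_arr (pt_arr e) ∘ pt_arr (pt_arr (fmap fibre_star (l _ (nest g))))).
    now rewrite fibre_star_arr.
  - intros P u v E.
    refine (f_equal (fun w : point_hom _ _ => pt_arr w)
      (un (point_over_one P) (over_one_hom u) (over_one_hom v) _)).
    do 2 apply point_hom_eq.
    change (pt_arr (pt_arr e) ∘ pt_arr (pt_arr (fmap fibre_star (over_one_hom u))) =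
      pt_arr (pt_arr e) ∘ pt_arr (pt_arr (fmap fibre_star (over_one_hom v)))).
    rewrite !fibre_star_arr.
    exact (f_equal (fun w : point_hom _ _ => pt_arr w) E).
Defined.

(** Up to the identifications [Pt_1 (Pt Y) = Pt Y] and
    [Pt_Q (Pt Y) = Pt (pt_dom Q)], pulling back along the split epimorphism
    underlying [Q] is pulling back along the terminal map of [Q] in [Pt Y]. *)
Lemma split_epi_right_adjoint (HA : acc (pt_finlim L Y)) :
  has_right_adjoint split_star.
Proof.
  destruct (HA Q) as [G]; constructor.
  apply adjoint_of_universal; intros B.
  apply split_universal, universal_of_adjoint, G.
Qed.
End SplitEpimorphism.

(** * Consequences of the Mal'cev property *)

(** With relations read on generalized elements, the relation on [E] given by
    [u ~ w] if and only if some [v] has [a v = a u] and [b v = b w] is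
    reflexive; difunctionality of [(a, b)] is its symmetry. *)
Lemma malcev_difunctional (C : category) (L : finlim C) (HM : malcev L)
    (E A B : C) (a : E ~> A) (b : E ~> B)
    (mono : forall (T : C) (u v : T ~> E), a ∘ u = a ∘ v -> b ∘ u = b ∘ v -> u = v)
    (T : C) (u v w : T ~> E) (eu : a ∘ u = a ∘ v) (ew : b ∘ v = b ∘ w) :
  exists z : T ~> E, a ∘ z = a ∘ w /\ b ∘ z = b ∘ u.
Proof.
  set (P1 := pb L a a).
  set (W := pb L (b ∘ pb_snd P1) b).
  assert (jm : jointly_monic (pb_fst P1 ∘ pb_fst W) (pb_snd W)).
  { intros S x y e1 e2; rewrite <- !comp_assoc in e1.
    apply pb_uniq; [ apply pb_uniq; [ exact e1 | ] | exact e2 ].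
    apply mono.
    - rewrite !(comp_assoc _ (pb_snd P1)), <- (pb_comm P1), <- !comp_assoc.
      now rewrite e1.
    - rewrite !comp_assoc, (pb_comm W), <- !comp_assoc.
      now rewrite e2. }
  assert (ed : (b ∘ pb_snd P1) ∘ pb_pair P1 (eq_refl (a ∘ idm E)) = b ∘ idm E)
    by (now rewrite <- comp_assoc, pb_pair_snd).
  assert (r0 : (pb_fst P1 ∘ pb_fst W) ∘ pb_pair W ed = idm E)
    by (now rewrite <- comp_assoc, !pb_pair_fst).
  assert (r1 : pb_snd W ∘ pb_pair W ed = idm E) by apply pb_pair_snd.
  destruct (HM E (ReflexiveRelation jm r0 r1)) as [[t [t0 t1]] _]; simpl in t, t0, t1.
  assert (ewP : (b ∘ pb_snd P1) ∘ pb_pair P1 eu = b ∘ w)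
    by (now rewrite <- comp_assoc, pb_pair_snd).
  set (q := pb_pair W ewP).
  assert (q0 : (pb_fst P1 ∘ pb_fst W) ∘ q = u)
    by (unfold q; now rewrite <- comp_assoc, !pb_pair_fst).
  assert (q1 : pb_snd W ∘ q = w) by apply pb_pair_snd.
  assert (tq0 : (pb_fst P1 ∘ pb_fst W) ∘ (t ∘ q) = w)
    by (now rewrite comp_assoc, t0).
  assert (tq1 : pb_snd W ∘ (t ∘ q) = u)
    by (now rewrite comp_assoc, t1).
  exists (pb_snd P1 ∘ pb_fst W ∘ (t ∘ q)); split.
  - rewrite <- tq0, !comp_assoc; now rewrite (pb_comm P1).
  - rewrite <- tq1, !comp_assoc; now rewrite (pb_comm W).
Qed.

(** The equalizer of [φ] and [ψ] is a relation between [P] and [Q] containing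
    both axes.  Difunctionality applied to [(s_P x, q)], [(s_P x, s_Q x)],
    [(p, s_Q x)] puts every [(p, q)] over [x] into it. *)
Lemma axes_jointly_epic (C : category) (L : finlim C) (HM : malcev L)
    (X : C) (P Q : Pt X) (D : pullback (pt_map P) (pt_map Q))
    (i : pt_dom P ~> pb_ob D) (j : pt_dom Q ~> pb_ob D)
    (i1 : pb_fst D ∘ i = idm _) (i2 : pb_snd D ∘ i = pt_sec Q ∘ pt_map P)
    (j1 : pb_fst D ∘ j = pt_sec P ∘ pt_map Q) (j2 : pb_snd D ∘ j = idm _)
    (Y : C) (φ ψ : pb_ob D ~> Y)
    (ei : φ ∘ i = ψ ∘ i) (ej : φ ∘ j = ψ ∘ j) :
  φ = ψ.
Proof.
  (* the equalizer, as the pullback of the diagonal along [(φ, ψ)] *)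
  set (E := pb L (pair L φ ψ) (pair L (idm Y) (idm Y))).
  assert (inE : forall (T : C) (x : T ~> pb_ob D), φ ∘ x = ψ ∘ x ->
    exists y : T ~> pb_ob E, pb_fst E ∘ y = x).
  { intros T x e.
    assert (e' : pair L φ ψ ∘ x = pair L (idm Y) (idm Y) ∘ (φ ∘ x)).
    { apply prod_uniq; rewrite !comp_assoc.
      - now rewrite !pr1_pair, comp_id_l.
      - now rewrite !pr2_pair, comp_id_l. }
    exists (pb_pair E e'); apply pb_pair_fst. }
  assert (onE : φ ∘ pb_fst E = ψ ∘ pb_fst E).
  { pose proof (pb_comm E) as c.
    pose proof (f_equal (comp (pr1 L Y Y)) c) as c1.
    pose proof (f_equal (comp (pr2 L Y Y)) c) as c2.
    rewrite !comp_assoc, !pr1_pair in c1; rewrite !comp_assoc, !pr2_pair in c2.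
    congruence. }
  assert (monoE : forall (T : C) (x y : T ~> pb_ob E),
    (pb_fst D ∘ pb_fst E) ∘ x = (pb_fst D ∘ pb_fst E) ∘ y ->
    (pb_snd D ∘ pb_fst E) ∘ x = (pb_snd D ∘ pb_fst E) ∘ y -> x = y).
  { intros T x y e1 e2; rewrite <- !comp_assoc in e1, e2.
    assert (e : pb_fst E ∘ x = pb_fst E ∘ y) by (apply pb_uniq; assumption).
    apply pb_uniq; [ exact e | ].
    assert (s : pb_snd E = φ ∘ pb_fst E).
    { pose proof (f_equal (comp (pr1 L Y Y)) (pb_comm E)) as c1.
      rewrite !comp_assoc, !pr1_pair, comp_id_l in c1; now symmetry. }
    now rewrite s, <- !comp_assoc, e. }
  destruct (inE _ (j ∘ pb_snd D)) as [u eu].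
  { now rewrite !comp_assoc, ej. }
  destruct (inE _ (i ∘ (pt_sec P ∘ (pt_map P ∘ pb_fst D)))) as [v ev].
  { now rewrite !(comp_assoc _ i), ei. }
  destruct (inE _ (i ∘ pb_fst D)) as [w ew].
  { now rewrite !comp_assoc, ei. }
  destruct (@malcev_difunctional C L HM _ _ _
    (pb_fst D ∘ pb_fst E) (pb_snd D ∘ pb_fst E) monoE _ u v w) as [z [z1 z2]].
  - rewrite <- !comp_assoc, eu, ev, !(comp_assoc _ _ (pb_fst D)), i1, j1.
    now rewrite comp_id_l, (pb_comm D), comp_assoc.
  - rewrite <- !comp_assoc, ev, ew, !(comp_assoc _ _ (pb_snd D)), i2.
    rewrite <- !(comp_assoc _ (pt_map P)), (comp_assoc _ (pt_sec P)), pt_split.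
    now rewrite comp_id_l.
  - assert (ez : pb_fst E ∘ z = idm _).
    { apply pb_uniq; rewrite comp_assoc, ?z1, ?z2, <- comp_assoc, comp_id_r.
      - now rewrite ew, comp_assoc, i1, comp_id_l.
      - now rewrite eu, comp_assoc, j2, comp_id_l. }
    now rewrite <- (comp_id_r φ), <- (comp_id_r ψ), <- ez, !comp_assoc, onE.
Qed.

(** The kernel pair of a map of points is again a point, so monomorphisms of
    [Pt X] are monic in the base. *)
Lemma point_mono_base_mono (C : category) (L : finlim C) (X : C)
    (P S : Pt X) (m : P ~> S)
    (mono : forall (A : Pt X) (u v : A ~> P), m ∘ u = m ∘ v -> u = v)
    (T : C) (a b : T ~> pt_dom P) (e : pt_arr m ∘ a = pt_arr m ∘ b) :
  a = b.
Proof.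
  pose proof (f_equal (fun w : point_hom _ _ => pt_arr w)
    (mono _ _ _ (pb_comm (pt_pb L m m)))) as k; simpl in k.
  set (K := pb L (pt_arr m) (pt_arr m)) in k.
  transitivity (pb_fst K ∘ pb_pair K e); [ symmetry; apply pb_pair_fst | ].
  rewrite k; apply pb_pair_snd.
Qed.

(** * The centralizer *)

Section CentralizerOfRelation.
Variables (C : category) (L : finlim C) (X : C) (R : equivalence_relation L X).

Local Notation d1_star := (change_of_base L (d1 R)).

(** On elements [p ↦ (s0 (f_P p), p)]: the injection of [P] into its product
    with [(R, d1, s0)] in [Pt X]. *)
Definition axis (P : Pt X) : pt_dom P ~> pb_ob (pb L (d1 R) (pt_map P)) :=
  pb_pair (pb L (d1 R) (pt_map P)) (restrict_inner_eq R P).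

Definition second_component (P : Pt X) (g : d1_star P ~> target_point R) :
    pb_ob (pb L (d1 R) (pt_map P)) ~> X :=
  pr2 L (rel_ob R) X ∘ pt_arr g.

Lemma second_component_inj (P : Pt X) (g h : d1_star P ~> target_point R) :
  second_component g = second_component h -> g = h.
Proof.
  intros e; apply point_hom_eq, prod_uniq; [ | exact e ].
  exact (eq_trans (pt_arr_map g) (eq_sym (pt_arr_map h))).
Qed.

(** A cooperator [R ×_X S ~> X × X] is a map over [X], so only its second
    component matters; being [(d1, d0)] on [R] says precisely that this
    component defines a map of points over [R] into [target_point R]. *)
Lemma relations_commute_iff (S : equivalence_relation L X) :
  relations_commute R S <->
  exists g : d1_star (rel_point0 S) ~> target_point R,
    second_component g ∘ axis (rel_point0 S) = d1 S.
Proof.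
  split.
  - intros [phi [e1 e2]].
    pose proof (f_equal (fun w : point_hom _ (square_point L X) => pr2 L X X ∘ pt_arr w) e1) as k1.
    pose proof (f_equal (fun w : point_hom _ (square_point L X) => pr2 L X X ∘ pt_arr w) e2) as k2.
    simpl in k1, k2; rewrite pr2_pair in k1, k2; clear e1 e2.
    unshelve eexists (@PointHom C (rel_ob R) (d1_star (rel_point0 S))
      (target_point R)
      (pair L (pb_fst (pb L (d1 R) (d0 S))) (pr2 L X X ∘ pt_arr phi))
      (pr1_pair _ _ _) _).
    + apply prod_uniq; simpl; rewrite comp_assoc.
      * now rewrite !pr1_pair, pb_pair_fst.
      * rewrite !pr2_pair, <- k1, <- comp_assoc; do 2 f_equal.
        apply pb_uniq; simpl.
        -- now rewrite !pb_pair_fst.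
        -- now rewrite !pb_pair_snd.
    + unfold second_component; simpl; rewrite pr2_pair, <- k2, <- comp_assoc.
      do 2 f_equal; apply pb_uniq; unfold axis; simpl.
      * now rewrite !pb_pair_fst.
      * now rewrite !pb_pair_snd.
  - intros [g e]; unfold second_component in e.
    pose proof (f_equal (comp (pr2 L (rel_ob R) X)) (pt_arr_sec g)) as k.
    simpl in k; rewrite pr2_pair in k.
    unshelve eexists (@PointHom C X
      (prod (pt_finlim L X) (rel_point1 R) (rel_point0 S)) (square_point L X)
      (pair L (d1 R ∘ pb_fst (pb L (d1 R) (d0 S))) (pr2 L (rel_ob R) X ∘ pt_arr g))
      (pr1_pair _ _ _) _).
    + apply prod_uniq; simpl; rewrite comp_assoc.
      * rewrite !pr1_pair, <- comp_assoc, pb_pair_fst; apply d1_s0.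
      * rewrite !pr2_pair, <- (d0_s0 R), <- k, <- !comp_assoc; do 2 f_equal.
        apply pb_uniq; simpl; rewrite comp_assoc.
        -- now rewrite !pb_pair_fst, comp_id_l.
        -- now rewrite !pb_pair_snd, <- comp_assoc, d1_s0, comp_id_r.
    + split; apply point_hom_eq, prod_uniq; simpl; rewrite comp_assoc.
      * now rewrite !pr1_pair, <- comp_assoc, pb_pair_fst, comp_id_r.
      * rewrite !pr2_pair, <- k, <- !comp_assoc; do 2 f_equal.
        apply pb_uniq; simpl.
        -- now rewrite !pb_pair_fst.
        -- now rewrite !pb_pair_snd.
      * now rewrite !pr1_pair, <- comp_assoc, pb_pair_fst, comp_assoc, d1_s0,
          comp_id_l.
      * rewrite !pr2_pair, <- e, <- !comp_assoc; do 2 f_equal.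
        apply pb_uniq; unfold axis; simpl.
        -- now rewrite !pb_pair_fst.
        -- now rewrite !pb_pair_snd.
Qed.

Variable Phi : right_adjoint d1_star.

Local Notation m := (centralizer_map Phi).

Definition transpose (P : Pt X) (u : P ~> Phi (target_point R)) :
    d1_star P ~> target_point R :=
  counit Phi (target_point R) ∘ fmap d1_star u.

(** Restricting the counit along [s0] evaluates it on the axis
    [p ↦ (s0 (f_P p), p)]. *)
Lemma centralizer_map_transpose (P : Pt X) (u : P ~> Phi (target_point R)) :
  (pr2 L X X ∘ pt_arr m) ∘ pt_arr u = second_component (transpose u) ∘ axis P.
Proof.
  unfold second_component, transpose, axis; simpl.
  rewrite !comp_assoc, pr2_pair.
  rewrite <- (comp_assoc _ (pb_snd _)), pb_pair_snd.
  rewrite <- !comp_assoc; do 2 f_equal.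
  rewrite (comp_assoc _ _ (pb_snd _)), pb_pair_snd.
  apply pb_uniq; rewrite !comp_assoc.
  - rewrite !pb_pair_fst, <- !comp_assoc; f_equal; apply pt_arr_map.
  - now rewrite !pb_pair_snd, <- comp_assoc, pb_pair_snd, comp_id_l, comp_id_r.
Qed.

Lemma centralizer_map_fst (P : Pt X) (u : P ~> Phi (target_point R)) :
  (pr1 L X X ∘ pt_arr m) ∘ pt_arr u = pt_map P.
Proof.
  rewrite <- (pt_arr_map u); f_equal; exact (pt_arr_map m).
Qed.

(** Two maps into [Phi (target_point R)] with the same composite have
    transposes agreeing on the axis of [P]; they agree on that of [R] because
    both are maps of points over [R]. *)
Lemma centralizer_map_mono (HM : malcev L) (P : Pt X)
    (u v : P ~> Phi (target_point R)) (e : m ∘ u = m ∘ v) :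
  u = v.
Proof.
  apply (@ua_uniq _ _ _ _ (universal_of_adjoint Phi (target_point R))); simpl.
  apply second_component_inj.
  apply (axes_jointly_epic HM (P := rel_point1 R) (Q := P)
    (D := pb L (d1 R) (pt_map P)) (i := pt_sec (d1_star P)) (j := axis P)).
  - apply pb_pair_fst.
  - apply pb_pair_snd.
  - apply pb_pair_fst.
  - apply pb_pair_snd.
  - transitivity (pr2 L (rel_ob R) X ∘ pt_sec (target_point R)); unfold second_component;
      rewrite <- comp_assoc; f_equal; [ | symmetry ].
    + exact (pt_arr_sec (transpose u)).
    + exact (pt_arr_sec (transpose v)).
  - refine (eq_trans (eq_sym (centralizer_map_transpose u))
      (eq_trans _ (centralizer_map_transpose v))).
    pose proof (f_equal (fun w : point_hom _ (square_point L X) => pr2 L X X ∘ pt_arr w) e) as k.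
    now rewrite <- !comp_assoc.
Qed.

Lemma centralizer_map_jointly_monic (HM : malcev L) :
  jointly_monic (pr1 L X X ∘ pt_arr m) (pr2 L X X ∘ pt_arr m).
Proof.
  intros T a b e1 e2; rewrite <- !comp_assoc in e1, e2.
  apply (point_mono_base_mono L (m := m) (centralizer_map_mono HM)).
  now apply prod_uniq.
Qed.

Lemma centralizer_map_is_centralizer
    (mono : jointly_monic (pr1 L X X ∘ pt_arr m) (pr2 L X X ∘ pt_arr m))
    (eqv : is_equivalence L (rel_of_point mono)) :
  is_centralizer R (EquivalenceRelation eqv).
Proof.
  set (Z := EquivalenceRelation eqv).
  split.
  - (* [Z] and [Phi (target_point R)] are the same point, up to the equality
       [pr1 ∘ m = pt_map _], which holds only propositionally *)
    assert (em : pt_map (Phi (target_point R)) ∘ idm _ = d0 Z).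
    { rewrite comp_id_r; symmetry; exact (pt_arr_map m). }
    pose (j := @PointHom C X (rel_point0 Z) (Phi (target_point R))
      (idm _) em (comp_id_l _)).
    apply relations_commute_iff; exists (transpose j).
    rewrite <- centralizer_map_transpose; apply comp_id_r.
  - intros S HS; apply relations_commute_iff in HS; destruct HS as [g e].
    pose (U := universal_of_adjoint Phi (target_point R)).
    pose (u := ua_lift U g : rel_point0 S ~> Phi (target_point R)).
    exists (pt_arr u); split; [ exact (centralizer_map_fst u) | ].
    refine (eq_trans (centralizer_map_transpose u) _).
    rewrite <- e; f_equal; f_equal; exact (ua_lift_arr U g).
Qed.
End CentralizerOfRelation.

Theorem proposition2p8 (C : category) (L : finlim C)
    (HM : malcev L) (HF : fiberwise_acc L)
    (X : C) (R : equivalence_relation L X) :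
  (exists Z : equivalence_relation L X, is_centralizer R Z) /\
  has_right_adjoint (change_of_base L (d1 R)) /\
  forall Phi : right_adjoint (change_of_base L (d1 R)),
    let m := centralizer_map Phi in
    exists (mono : jointly_monic (pr1 L X X ∘ pt_arr m) (pr2 L X X ∘ pt_arr m))
           (eqv : is_equivalence L (rel_of_point mono)),
      is_centralizer R (EquivalenceRelation eqv).
Proof.
  assert (adj : has_right_adjoint (change_of_base L (d1 R)))
    by exact (split_epi_right_adjoint (rel_point1 R) (HF X)).
  assert (main : forall Phi : right_adjoint (change_of_base L (d1 R)),
    let m := centralizer_map Phi in
    exists (mono : jointly_monic (pr1 L X X ∘ pt_arr m) (pr2 L X X ∘ pt_arr m))
           (eqv : is_equivalence L (rel_of_point mono)),
      is_centralizer R (EquivalenceRelation eqv)).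
  { intros Phi.
    exists (centralizer_map_jointly_monic HM (Phi := Phi)), (HM _ _).
    apply centralizer_map_is_centralizer. }
  split; [ | split; assumption ].
  destruct adj as [Phi]; destruct (main Phi) as (mono & eqv & H).
  now exists (EquivalenceRelation eqv).
Qed.
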